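(* Let $n,k_1,k_2,t$ be positive integers with $k_1,k_2\ge t$ and $n\ge k_1+k_2+3$. Suppose that $\mathcal{F}_1\subseteq\mathcal{M}(k_1,n)$ and $\mathcal{F}_2\subseteq\mathcal{M}(k_2,n)$ are cross $t$-intersecting families such that $|\mathcal{F}_1|\cdot|\mathcal{F}_2|$ is maximum among all pairs of cross $t$-intersecting families $\mathcal{F}_1\subseteq\mathcal{M}(k_1,n)$, $\mathcal{F}_2\subseteq\mathcal{M}(k_2,n)$. Then there exists a $t$-flat of $AG(n,\mathbb{F}_q)$ contained in every member of $\mathcal{F}_1$ and of $\mathcal{F}_2$.
   Context: $q$ is a prime power and $AG(n,\mathbb{F}_q)$ is the $n$-dimensional affine space over $\mathbb{F}_q$: a $k$-flat is a coset $P+x$ of a $k$-dimensional subspace $P$ of $\mathbb{F}_q^n$, and its dimension is $\dim P$. $\mathcal{M}(k,n)$ denotes the set of all $k$-flats. The intersection of two flats is either a flat or empty; the empty set is regarded as having dimension smaller than every nonnegative integer. Families $\mathcal{F}_1\subseteq\mathcal{M}(k_1,n)$ and $\mathcal{F}_2\subseteq\mathcal{M}(k_2,n)$ are cross $t$-intersecting if $\dim(F_1\cap F_2)\ge t$ for all $F_1\in\mathcal{F}_1$, $F_2\in\mathcal{F}_2$. *)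

(* Defs.v *)
From mathcomp Require Import all_boot all_order all_algebra.

Set Implicit Arguments.
Unset Strict Implicit.
Unset Printing Implicit Defensive.

Local Open Scope ring_scope.

Section AffineFlats.

Variables (F : finFieldType) (n : nat).

Implicit Types (A : {set 'rV[F]_n}) (Fam : {set {set 'rV[F]_n}}).

Definition coset_of_vspace (P : {vspace 'rV[F]_n}) (x : 'rV[F]_n) :
    {set 'rV[F]_n} :=
  [set p + x | p : 'rV[F]_n & p \in P].

Definition is_flat (k : nat) A : Prop :=
  exists P : {vspace 'rV[F]_n}, exists x : 'rV[F]_n,
    \dim P = k /\ A = coset_of_vspace P x.

(* The empty set is not a flat, so it fails [flat_dim_ge t] for every [t]. *)
Definition flat_dim_ge (t : nat) A : Prop :=
  exists m : nat, (t <= m)%N /\ is_flat m A.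

Definition flat_family (k : nat) Fam : Prop :=
  forall A, A \in Fam -> is_flat k A.

Definition cross_intersecting (t : nat) Fam1 Fam2 : Prop :=
  forall A B, A \in Fam1 -> B \in Fam2 -> flat_dim_ge t (A :&: B).

End AffineFlats.

(* Main.v *)
Require Import Defs.
From mathcomp Require Import all_boot all_order all_algebra.
From mathcomp Require Import finfield ring lra zify.

(** Write [q] for the order of the field and, for a family [G] and a flat [S],
    [G_S] for the members of [G] through [S].  Counting pairs [(A, x)] with [A]
    in [G_S] and [x] in [(A :&: B) :\: S] for a suitable flat [B] bounds [|G_S|]
    by a constant times the largest [|G_S'|], where [S'] is a flat spanned by
    [S] and one more point.  Let [s1] (resp. [s2]) be the least dimension of a
    flat meeting every member of [F1] (resp. [F2]) in dimension at least [t].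
    Taking for [B] such a least flat as long as [S] has dimension below [t],
    and then a member of the other family meeting [S] in dimension below [t]
    as long as the dimension is below [s2], bounds [|F1|]; [|F2|] is bounded
    in the same way.  Since [n >= k1 + k2 + 3], the product of the two bounds
    is smaller than the value reached by all flats through a fixed [t]-flat,
    unless [s1 = s2 = t].  In that case [F1] consists of all [k1]-flats through
    one [t]-flat [T], and such a flat can be chosen to meet a given [B] in [F2]
    only inside [T], so [B] contains [T]. *)

Set Implicit Arguments.
Unset Strict Implicit.
Unset Printing Implicit Defensive.

Import Order.TTheory GRing.Theory Num.Theory.

Section Flats.

(** * Flats as affinely closed sets with [q^k] points *)

Variables (F : finFieldType) (n : nat).

Local Notation V := 'rV[F]_n.
Local Notation q := #|F|.

Implicit Types (A B S T : {set V}) (G : {set {set V}}).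

(** Three points are used because closure under lines through two points is vacuous over the field
    with two elements. The empty set qualifies; the cardinality in [flat] excludes it. *)
Definition affine_closed A :=
  [forall x in A, forall y in A, forall z in A, forall c : F,
     (x + c *: (y - z))%R \in A].

Definition flat (k : nat) A := affine_closed A && (#|A| == q ^ k).

Lemma affine_closedP A :
  reflect (forall x y z c, x \in A -> y \in A -> z \in A ->
             (x + c *: (y - z))%R \in A)
          (affine_closed A).
Proof.
apply: (iffP idP) => [cA x y z c xA yA zA | cA].
  move: cA => /forall_inP/(_ x xA)/forall_inP/(_ y yA)/forall_inP/(_ z zA).
  by move/forallP.
apply/forall_inP => x xA; apply/forall_inP => y yA; apply/forall_inP => z zA.
by apply/forallP => c; apply: cA.
Qed.

Lemma q_gt1 : 1 < q.
Proof. exact: finNzRing_gt1. Qed.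

Lemma q_gt0 : 0 < q.
Proof. exact: ltnW q_gt1. Qed.

Lemma mem_coset (P : {vspace V}) (x y : V) :
  (y \in coset_of_vspace P x) = ((y - x)%R \in P).
Proof.
apply/imsetP/idP => [[p + ->] | yxP]; first by rewrite addrK inE.
by exists (y - x)%R; rewrite ?inE ?subrK.
Qed.

Lemma card_coset (P : {vspace V}) (x : V) :
  #|coset_of_vspace P x| = q ^ \dim P.
Proof.
rewrite card_imset; last exact: addIr.
rewrite -(card_vspace (P : {vspace Vector.Pack (Vector.class V)})).
by apply: eq_card => v; rewrite inE.
Qed.

Lemma coset_affine_closed (P : {vspace V}) (x : V) :
  affine_closed (coset_of_vspace P x).
Proof.
apply/affine_closedP => u v w c; rewrite !mem_coset => uP vP wP.
have -> : (u + c *: (v - w) - x = (u - x) + c *: ((v - x) - (w - x)))%R.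
  by rewrite opprB addrA subrK addrAC.
by rewrite rpredD // rpredZ // rpredB.
Qed.

Lemma coset_flat (P : {vspace V}) (x : V) :
  flat (\dim P) (coset_of_vspace P x).
Proof. by rewrite /flat coset_affine_closed card_coset eqxx. Qed.

(** The direction space is spanned by the differences [y - x]. Adding a multiple of one of them to a
    point of [A] stays in [A], so [A] absorbs the span term by term. *)
Lemma affine_closed_coset A (x : V) :
  affine_closed A -> x \in A -> exists P, A = coset_of_vspace P x.
Proof.
move=> /affine_closedP cA xA.
pose X := [tuple of [seq (y - x)%R | y <- enum A]].
exists <<X>>%VS; apply/setP => y; rewrite mem_coset.
apply/idP/idP => [yA | /coord_span yX].
  by apply/memv_span/mapP; exists y; rewrite // mem_enum.
rewrite -(subrK x y) {}yX.
elim/big_rec: _ => [|i v _ vA]; first by rewrite add0r.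
have /mapP[z] : (X`_i)%R \in X by rewrite mem_nth // size_tuple.
rewrite mem_enum => zA ->.
by rewrite -addrA addrC cA.
Qed.

Lemma flatP k A : reflect (is_flat k A) (flat k A).
Proof.
apply: (iffP andP) => [[cA /eqP kA] | [P [x [<- ->]]]]; last first.
  by apply/andP; exact: coset_flat.
have /card_gt0P[x xA] : 0 < #|A| by rewrite kA expn_gt0 q_gt0.
have [P AP] := affine_closed_coset cA xA.
exists P, x; split=> //; apply/eqP.
by rewrite -(eqn_exp2l _ _ q_gt1) -kA AP card_coset.
Qed.

Lemma card_flat k A : flat k A -> #|A| = q ^ k.
Proof. by case/andP=> _ /eqP. Qed.

Lemma flat_inter a b A B :
  flat a A -> flat b B -> A :&: B != set0 -> exists j, flat j (A :&: B).
Proof.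
move=> /andP[/affine_closedP cA _] /andP[/affine_closedP cB _] /set0Pn[x xAB].
have cAB : affine_closed (A :&: B).
  apply/affine_closedP => u v w c.
  move=> /setIP[? ?] /setIP[? ?] /setIP[? ?].
  by rewrite inE cA ?cB.
have [P ->] := affine_closed_coset cAB xAB.
by exists (\dim P); exact: coset_flat.
Qed.

Lemma flat_dim_geP a b t A B : flat a A -> flat b B ->
  flat_dim_ge t (A :&: B) <-> q ^ t <= #|A :&: B|.
Proof.
move=> fA fB; split=> [[m [tm /flatP/card_flat ->]] | tAB].
  by rewrite leq_exp2l ?q_gt1.
have [|j fj] := flat_inter fA fB.
  by rewrite -card_gt0 (leq_trans _ tAB) // expn_gt0 q_gt0.
exists j; split; last exact/flatP.
by rewrite -(leq_exp2l _ _ q_gt1) -(card_flat fj).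
Qed.

(** An intersection of flats has 0 or [q^j] points, so no size lies strictly between [q^t] and
    [q^t.+1]. *)
Lemma card_inter_small a b t A B : flat a A -> flat b B ->
  #|A :&: B| < q ^ t.+1 -> #|A :&: B| <= q ^ t.
Proof.
move=> fA fB; have [-> _ | AB0] := eqVneq (A :&: B) set0.
  by rewrite cards0.
have [j /card_flat ->] := flat_inter fA fB AB0.
by rewrite ltn_exp2l ?q_gt1 // ltnS leq_exp2l ?q_gt1.
Qed.

(** * Extending flats by points *)

Lemma flat_extend s S (x : V) : flat s S -> x \notin S ->
  exists S', [/\ flat s.+1 S', S \subset S', x \in S' &
    forall A, affine_closed A -> S \subset A -> x \in A -> S' \subset A].
Proof.
move=> /flatP[P [y [<- ->]]]; rewrite mem_coset => xyP.
exists (coset_of_vspace (P + <[x - y]>)%VS y); split.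
- have <- : \dim (P + <[(x - y)%R]>)%VS = (\dim P).+1; last exact: coset_flat.
  rewrite dimv_disjoint_sum ?dim_vline.
    by have [e|] := eqVneq (x - y)%R 0%R; rewrite ?addn1 //; rewrite e mem0v in xyP.
  apply/eqP; rewrite -subv0; apply/subvP => v; rewrite memv_cap memv0.
  case/andP=> vP /vlineP[c cv]; rewrite cv scaler_eq0.
  have [//|c0] := eqVneq c 0%R.
  by case/negP: xyP; rewrite -[(x - y)%R](scalerK c0) -cv memvZ.
- by apply/subsetP => z; rewrite !mem_coset; apply/subvP/addvSl.
- by rewrite mem_coset; apply/(subvP (addvSr _ _))/memv_line.
move=> A cA PA xA.
have yA : y \in A by rewrite (subsetP PA) // mem_coset subrr mem0v.
apply/subsetP => z; rewrite mem_coset => /memv_addP[p pP [w /vlineP[c ->] zE]].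
have pyA : (p + y)%R \in A by rewrite (subsetP PA) // mem_coset addrK.
have -> : z = (p + y + c *: (x - y))%R by rewrite addrAC -zE subrK.
by move/affine_closedP: cA; apply.
Qed.

Lemma flat_set1 (x : V) : flat 0 [set x].
Proof.
rewrite /flat cards1 expn0 eqxx andbT; apply/affine_closedP => u v w c.
by move=> /set1P-> /set1P-> /set1P->; rewrite subrr scaler0 addr0 set11.
Qed.

Lemma card_space : #|{: V}| = q ^ n.
Proof. by rewrite card_mx mul1n. Qed.

Lemma flat_exists_notin s S : flat s S -> s < n -> exists x, x \notin S.
Proof.
move=> fS sn; have /card_gt0P[x] : 0 < #|~: S|.
  by rewrite cardsCs setCK card_space (card_flat fS) subn_gt0 ltn_exp2l ?q_gt1.
by rewrite inE; exists x.
Qed.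

Lemma flat_exists k : k <= n -> exists S, flat k S.
Proof.
elim: k => [_|k IH kn]; first by exists [set 0%R]; exact: flat_set1.
have [S fS] := IH (ltnW kn); have [x xS] := flat_exists_notin fS kn.
by have [S' [fS' _ _ _]] := flat_extend fS xS; exists S'.
Qed.

Lemma flat_sub_eq s A B : flat s A -> flat s B -> A \subset B -> A = B.
Proof.
move=> fA fB AB; apply/eqP.
by rewrite eqEcard AB (card_flat fA) (card_flat fB) leqnn.
Qed.

(* Extending T greedily towards dimension k without enlarging the trace on B:
   a new point y is harmless if it avoids all the flats spanned by the current
   flat and a point of B, and these cover fewer than q^n points. *)
Lemma flat_extend_avoiding t k b T B : flat t T -> flat b B ->
  t <= k -> k + b < n ->
  exists A, [/\ flat k A, T \subset A & A :&: B \subset T].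
Proof.
move=> fT fB; elim: k => [|k IH] tk kbn.
  exists T; split; rewrite ?subsetIl //.
  by move: tk; rewrite leqn0 => /eqP t0; rewrite -t0.
move: tk; rewrite leq_eqVlt => /orP[/eqP tk|tk].
  by exists T; rewrite -tk subsetIl.
have [||A [fA TA ABT]] := IH; [lia|lia|].
(* For [x] outside [A] this is the flat spanned by [A] and [x], and the [odflt] default is never
   reached. Taking [A] itself otherwise keeps [A \subset sp x] in every case. *)
pose sp x := if x \in A then A else
  odflt A [pick S' | [&& flat k.+1 S', A \subset S' & x \in S']].
have cardsp x : #|sp x| <= q ^ k.+1.
  have cA : #|A| <= q ^ k.+1 by rewrite (card_flat fA) leq_exp2l ?q_gt1.
  rewrite /sp; case: ifP => // _; case: pickP => [S' /and3P[fS' _ _]|_] //=.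
  by rewrite (card_flat fS').
have cU : #|\bigcup_(x in B) sp x| < q ^ n.
  apply: (@leq_ltn_trans (\sum_(x in B) q ^ k.+1)).
    elim/big_rec2: _ => [|x m U xB Um]; first by rewrite cards0.
    by rewrite (leq_trans (leq_card_setU _ _)) // leq_add.
  by rewrite sum_nat_const (card_flat fB) -expnD ltn_exp2l ?q_gt1 // addnC.
have [y yU yA] : exists2 y, y \notin \bigcup_(x in B) sp x & y \notin A.
  have /card_gt0P[b0 b0B] : 0 < #|B| by rewrite (card_flat fB) expn_gt0 q_gt0.
  have /card_gt0P[y] : 0 < #|~: \bigcup_(x in B) sp x|.
    by rewrite cardsCs setCK card_space subn_gt0.
  rewrite inE => yU; exists y => //; apply: contra yU => yA.
  apply/bigcupP; exists b0 => //; rewrite /sp; case: ifP => // _.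
  by case: pickP => [S' /and3P[_ /subsetP AS' _]|_] //=; exact: AS'.
have [A' [fA' AA' yA' _]] := flat_extend fA yA.
exists A'; split=> //; first exact: subset_trans AA'.
apply/subsetP => x /setIP[xA' xB].
have [xA|xA] := boolP (x \in A); first by rewrite (subsetP ABT) // inE xA.
case/bigcupP: yU; exists x => //; rewrite /sp (negPf xA).
(* The flat spanned by [A] and [x] lies in [A'] and has the same dimension, so it is [A']; then [y]
   lies in [sp x], against its choice. *)
have [S' [fS' AS' xS' minS']] := flat_extend fA xA.
have S'A' : S' = A'.
  by apply: (flat_sub_eq fS' fA'); apply: minS' => //; case/andP: fA'.
case: pickP => [S'' /and3P[fS'' AS'' xS'']|/(_ S')] /=; last by rewrite fS' AS' xS'.
have <- : S' = S''; last by rewrite S'A'.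
by apply: (flat_sub_eq fS' fS''); apply: minS' => //; case/andP: fS''.
Qed.

(** * Double counting over the members through a flat *)

Definition over G S := [set A in G | S \subset A].

Definition flats (k : nat) : {set {set V}} := [set A | flat k A].

Local Notation Q := (q%:R : rat).
Local Open Scope ring_scope.

Lemma Q_ge2 : 2 <= Q.
Proof. by rewrite (ler_nat _ 2) q_gt1. Qed.

Lemma QX_gt0 i : 0 < Q ^+ i.
Proof. by rewrite exprn_gt0 // (lt_le_trans _ Q_ge2). Qed.

Lemma QX_lt i j : (i < j)%N -> Q ^+ i < Q ^+ j.
Proof. by move=> ij; rewrite -!natrX ltr_nat ltn_exp2l ?q_gt1. Qed.

Lemma QX_le i j : (i <= j)%N -> Q ^+ i <= Q ^+ j.
Proof. by move=> ij; rewrite -!natrX ler_nat leq_exp2l ?q_gt1. Qed.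

Lemma sum_over_trace G S B :
  (\sum_(A in over G S) #|(A :&: B) :\: S| =
   \sum_(x in B :\: S) #|over (over G S) [set x]|)%N.
Proof.
have E A : (#|(A :&: B) :\: S| = \sum_(x in B :\: S) (x \in A))%N.
  rewrite -sum1_card -big_mkcondr /=; apply: eq_bigl => x.
  by rewrite !inE; do 3!case: (x \in _).
under eq_bigr do rewrite E.
rewrite exchange_big; apply: eq_bigr => x _.
rewrite -sum1_card [RHS](eq_bigl (fun A => (A \in over G S) && (x \in A))).
  by rewrite big_mkcondr.
by move=> A; rewrite inE sub1set.
Qed.

(** Both sides bound the number of pairs [(A, x)] with [x] in [(A :&: B) :\: S]: the left side
    member by member, the right side point by point. *)
Lemma over_trace_le G S B (a b M : rat) :
  (forall A, A \in over G S -> a <= #|(A :&: B) :\: S|%:R) ->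
  #|B :\: S|%:R <= b -> 0 <= M ->
  (forall x, x \in B :\: S -> #|over (over G S) [set x]|%:R <= M) ->
  #|over G S|%:R * a <= b * M.
Proof.
move=> ha hb M0 hM.
apply: (@le_trans _ _ (\sum_(A in over G S) #|(A :&: B) :\: S|)%:R).
  rewrite natr_sum mulr_natl -sumr_const; exact: ler_sum.
rewrite sum_over_trace natr_sum; apply: (@le_trans _ _ (#|B :\: S|%:R * M)).
  rewrite mulr_natl -sumr_const; exact: ler_sum.
exact: ler_wpM2r.
Qed.

(** Minimality of the spanned flat turns a count through [S] and a point into a count through a flat
    one dimension higher, which is what the inductions below recurse on. *)
Lemma over_extend k s S (x : V) : flat s S -> x \notin S ->
  exists S', [/\ flat s.+1 S', S \subset S',
     forall A, affine_closed A -> S \subset A -> x \in A -> S' \subset A &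
     forall G, flat_family k G -> over (over G S) [set x] = over G S'].
Proof.
move=> fS xS; have [S' [fS' SS' xS' minS']] := flat_extend fS xS.
exists S'; split=> // G fG; apply/setP => A; rewrite !inE sub1set.
apply/idP/idP => [/andP[/andP[AG SA] xA] | /andP[AG S'A]].
  rewrite AG minS' //; have /flatP := fG _ AG; by case/andP.
by rewrite AG (subset_trans SS' S'A) (subsetP S'A).
Qed.

(** * The number of [k]-flats through a given flat *)

Lemma flats_family k : flat_family k (flats k).
Proof. by move=> A; rewrite inE => /flatP. Qed.

Lemma over_family k G S : flat_family k G -> flat_family k (over G S).
Proof. by move=> fG A; rewrite inE => /andP[/fG]. Qed.

(* The number of k-flats through a (k - d)-flat, by recursion on d. *)
Fixpoint nflats k d : rat :=
  if d is d'.+1 then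
    (Q ^+ n - Q ^+ (k - d)) / (Q ^+ k - Q ^+ (k - d)) * nflats k d'
  else 1.

(** With the whole space as [B] the double count is exact: all members have equally many points
    outside [S], and by induction all these points lie on equally many members. *)
Lemma card_over_flats k d S : (d <= k <= n)%N -> flat (k - d) S ->
  #|over (flats k) S|%:R = nflats k d.
Proof.
elim: d S => [|d IH] S /andP[dk kn] fS.
  rewrite subn0 in fS; have -> : over (flats k) S = [set S]; last by rewrite cards1.
  apply/setP => A; rewrite !inE; apply/andP/eqP => [[fA SA]| ->] //.
  by rewrite (flat_sub_eq fS fA SA).
have D0 : Q ^+ k - Q ^+ (k - d.+1) != 0.
  by rewrite subr_eq0 gt_eqF // QX_lt //; lia.
have cD B j : S \subset B -> flat j B -> #|B :\: S|%:R = Q ^+ j - Q ^+ (k - d.+1).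
  move=> SB fB; rewrite cardsD (setIidPr SB) natrB; last exact: subset_leq_card.
  by rewrite (card_flat fB) (card_flat fS) !natrX.
apply: (mulIf D0); rewrite /= mulrAC divfK //.
have := congr1 (fun m => m%:R : rat) (sum_over_trace (flats k) S setT).
rewrite !natr_sum.
under eq_bigr => A /[!inE] /andP[fA SA] do rewrite setIT (cD _ _ SA fA).
rewrite sumr_const mulr_natl => ->.
rewrite (eq_bigr (fun=> nflats k d)) => [|x].
  rewrite sumr_const -[LHS]mulr_natl; congr (_ * _).
  rewrite cardsD setTI cardsT card_space natrB.
    by rewrite (card_flat fS) !natrX.
  by rewrite -card_space max_card.
rewrite !inE andbT => xS.
have [S' [fS' _ _ ->]] := over_extend k fS xS; last exact: flats_family.
apply: IH; first by rewrite kn ltnW.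
by move: fS'; congr (is_true (flat _ _)); lia.
Qed.

Lemma nflats_gt0 k d : (d <= k <= n)%N -> 0 < nflats k d.
Proof.
elim: d => [//|d IH] /andP[dk kn] /=.
by rewrite mulr_gt0 ?IH ?kn 1?ltnW // divr_gt0 // subr_gt0 QX_lt; lia.
Qed.

(** Subtracting the same power from [q^n] and [q^k] only raises their quotient above [q^(n - k)]. *)
Lemma nflats_step k d : (d < k <= n)%N ->
  Q ^+ (n - k) * nflats k d <= nflats k d.+1.
Proof.
move=> /andP[dk kn] /=; apply: ler_wpM2r.
  by apply/ltW/nflats_gt0; rewrite kn ltnW.
rewrite ler_pdivlMr; last by rewrite subr_gt0 QX_lt //; lia.
rewrite mulrBr -!exprD subnK // lerD2l lerN2; apply: QX_le; lia.
Qed.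

Lemma nflats_growth k d m : (d + m <= k <= n)%N ->
  (Q ^+ (n - k)) ^+ m * nflats k d <= nflats k (d + m).
Proof.
elim: m => [|m IH] /andP[dk kn]; first by rewrite expr0 mul1r addn0.
rewrite addnS exprS -mulrA; apply: le_trans (nflats_step _); last lia.
by rewrite ler_pM2l ?QX_gt0 // IH //; lia.
Qed.

Lemma card_over_le k s G S : flat_family k G -> (s <= k <= n)%N -> flat s S ->
  #|over G S|%:R <= nflats k (k - s).
Proof.
move=> fG skn fS; rewrite -(@card_over_flats k (k - s) S); first last.
- by have -> : (k - (k - s) = s)%N by lia.
- by lia.
rewrite ler_nat subset_leq_card //; apply/subsetP => A; rewrite !inE.
by case/andP=> /fG/flatP -> ->.
Qed.

(** * Bounds from flats that are not covers *)

Lemma card_traceD A B S : S \subset A ->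
  #|(A :&: B) :\: S|%:R = #|A :&: B|%:R - #|S :&: B|%:R :> rat.
Proof.
move=> SA; rewrite cardsD setIAC (setIidPr SA) natrB //.
by rewrite subset_leq_card // setSI.
Qed.

(* The loss factor of one extension step when the base S is not a cover:
   |A :&: B| >= q^(t+1) and |S :&: B| <= q^t, whereas |B| = q^k. *)
Definition ext k t : rat := Q ^+ k / (Q ^+ t.+1 - Q ^+ t).

Lemma ext_gt0 k t : 0 < ext k t.
Proof. by rewrite divr_gt0 ?QX_gt0 // subr_gt0 QX_lt. Qed.

(** Below dimension [tau] some [B] in [G'] meets [S] in at most [q^t] points, while members of [G]
    meet it in at least [q^t.+1]. Each added dimension thus costs one factor [ext k' t], and [d] of
    them lead to dimension [tau]. *)
Lemma card_over_noncover k k' t tau (G G' : {set {set V}}) d s S :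
  flat_family k G -> flat_family k' G' ->
  (forall A B, A \in G -> B \in G' -> q ^ t.+1 <= #|A :&: B|)%N ->
  (forall j R, flat j R -> (j < tau)%N ->
     exists2 B, B \in G' & (#|R :&: B| < q ^ t.+1)%N) ->
  (tau <= k <= n)%N -> flat s S -> (s + d = tau)%N ->
  #|over G S|%:R <= ext k' t ^+ d * nflats k (k - tau).
Proof.
move=> fG fG' cross ncov tkn; elim: d s S => [|d IH] s S fS sd.
  rewrite expr0 mul1r -sd addn0; apply: card_over_le => //; lia.
have [|B BG' SB] := ncov _ _ fS; first lia.
have fB : flat k' B by apply/flatP/fG'.
have D0 : 0 < Q ^+ t.+1 - Q ^+ t by rewrite subr_gt0 QX_lt.
have M0 : 0 <= ext k' t ^+ d * nflats k (k - tau).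
  rewrite mulr_ge0 ?exprn_ge0 ?ltW ?ext_gt0 ?nflats_gt0 //; lia.
rewrite exprS {1}/ext -[X in _ <= X]mulrA mulrAC ler_pdivlMr //.
apply: (over_trace_le (B := B)) => //.
- move=> A; rewrite inE => /andP[AG SA]; rewrite card_traceD // -!natrX.
  by apply: lerB; rewrite ler_nat ?cross // (card_inter_small fS fB).
- by rewrite -natrX -(card_flat fB) ler_nat subset_leq_card // subsetDl.
move=> x; rewrite inE => /andP[xS _].
have [S' [fS' _ _ ->]] := over_extend k fS xS => //.
by apply: (IH s.+1) => //; lia.
Qed.

(** * Gaussian coefficients and bounds from a cover *)

Definition gauss_num t s : rat := \prod_(i < t) (Q ^+ s - Q ^+ i).

Lemma gauss_num_gt0 t s : (t <= s)%N -> 0 < gauss_num t s.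
Proof.
move=> ts; apply: prodr_gt0 => i _; rewrite subr_gt0 QX_lt //.
exact: leq_trans ts.
Qed.

(* The number of t-flats contained in an s-flat. *)
Definition nsub t s : rat :=
  Q ^+ (s - t) * (gauss_num t s / gauss_num t t).

Lemma nsub_gt0 t s : (t <= s)%N -> 0 < nsub t s.
Proof. by move=> ts; rewrite mulr_gt0 ?divr_gt0 ?QX_gt0 ?gauss_num_gt0. Qed.

Lemma nsubnn t : nsub t t = 1.
Proof. by rewrite /nsub subnn mul1r divff // gt_eqF ?gauss_num_gt0. Qed.

(** Since [q^(s+1) - q^(i+1) = q (q^s - q^i)], the two products share all factors but one each, up
    to powers of [q]. *)
Lemma gauss_num_step t m :
  gauss_num t.+1 (t + m).+2 * (Q ^+ m.+1 - 1) =
  (Q ^+ (t + m).+2 - 1) * gauss_num t.+1 (t + m).+1.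
Proof.
rewrite /gauss_num big_ord_recl big_ord_recr /= expr0.
under eq_bigr => i _ do
  rewrite /= /bump /= add1n !(exprS _ _.+1) [Q ^+ i.+1]exprS -mulrBr.
rewrite big_split /= prodr_const card_ord -!mulrA; congr (_ * _).
rewrite mulrCA; congr (_ * _).
have -> : Q ^+ (t + m).+1 = Q ^+ t * Q ^+ m.+1 by rewrite -exprD addnS.
by ring.
Qed.

(** The ratio is [(q^(t+m+2) - 1) / (q^(m+1) - 1)], and [q^m <= (q^(m+1) - 1) (q - 1)]. Equality
    occurs for [q = 2], [m = 0], so strictness comes from the [- 1] in the numerator. *)
Lemma gauss_num_step_lt t m :
  gauss_num t.+1 (t.+1 + m.+1) <
  (Q - 1) * Q ^+ t.+2 * gauss_num t.+1 (t.+1 + m).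
Proof.
have Q2 := Q_ge2.
rewrite addnS addSn.
have m0 : 0 < Q ^+ m.+1 - 1 by rewrite subr_gt0 -[1](expr0 Q) QX_lt.
rewrite -(ltr_pM2r m0) gauss_num_step mulrAC ltr_pM2r; last first.
  by apply: gauss_num_gt0; rewrite ltnS leq_addr.
have -> : Q ^+ (t + m).+2 = Q ^+ t.+2 * Q ^+ m by rewrite -exprD.
have := QX_gt0 t.+2; have := QX_le (leq0n m); rewrite expr0 (exprS _ m).
move: (Q ^+ t.+2) (Q ^+ m) => u v v1 u0.
have h1 : v <= Q * v - 1 by nra.
have h : v <= (Q * v - 1) * (Q - 1).
  apply: (le_trans h1); rewrite ler_peMr //; lra.
have := ler_wpM2l (ltW u0) h; lra.
Qed.

Lemma gauss_num_lt t m :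
  gauss_num t.+1 (t.+1 + m.+1) <
    ((Q - 1) * Q ^+ t.+2) ^+ m.+1 * gauss_num t.+1 t.+1.
Proof.
have C0 : 0 < (Q - 1) * Q ^+ t.+2.
  by rewrite mulr_gt0 ?QX_gt0 // subr_gt0 (lt_le_trans _ Q_ge2).
elim: m => [|m IH]; first by have := gauss_num_step_lt t 0; rewrite addn0.
by apply: lt_trans (gauss_num_step_lt t m.+1) _; rewrite [_ ^+ m.+2]exprS -[ltRHS]mulrA ltr_pM2l.
Qed.

(** Here the cover [T] serves as [B] at each step, so the growing flat stays inside [T]; a member
    through [S] has at least [q^t - q^j] of the [q^s - q^j] points of [T] outside [S]. *)
Lemma card_over_cover k t s (G : {set {set V}}) T X d j S :
  flat_family k G -> flat s T -> (t <= s)%N ->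
  (forall A, A \in G -> (q ^ t <= #|A :&: T|)%N) ->
  0 <= X -> (forall R, flat t R -> #|over G R|%:R <= X) ->
  (j + d = t)%N -> flat j S -> S \subset T ->
  #|over G S|%:R <=
    \prod_(j <= i < t) ((Q ^+ s - Q ^+ i) / (Q ^+ t - Q ^+ i)) * X.
Proof.
move=> fG fT ts cov X0 hX; elim: d j S => [|d IH] j S jd fS ST.
  by rewrite -jd addn0 big_geq // mul1r; apply: hX; rewrite -jd addn0.
have jt : (j < t)%N by lia.
rewrite big_ltn // -[leRHS]mulrA mulrAC ler_pdivlMr ?subr_gt0 ?QX_lt //.
apply: (over_trace_le (B := T)) => //.
- move=> A; rewrite inE => /andP[AG SA]; rewrite card_traceD // (setIidPl ST).
  by rewrite (card_flat fS) natrX lerD2r -natrX ler_nat cov.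
- rewrite cardsD (setIidPr ST) natrB ?subset_leq_card //.
  by rewrite (card_flat fS) (card_flat fT) !natrX.
- rewrite mulr_ge0 // big_nat_cond prodr_ge0 // => i /andP[/andP[_ it] _].
  by rewrite divr_ge0 // subr_ge0 QX_le //; lia.
move=> x; rewrite inE => /andP[xS xT].
have [S' [fS' _ minS' ->]] := over_extend k fS xS => //.
apply: (IH j.+1) => //; first lia.
by apply: minS' => //; case/andP: fT.
Qed.

Lemma card_cover k t s (G : {set {set V}}) T X :
  flat_family k G -> flat s T -> (t <= s)%N ->
  (forall A, A \in G -> (q ^ t <= #|A :&: T|)%N) ->
  0 <= X -> (forall R, flat t R -> #|over G R|%:R <= X) ->
  #|G|%:R <= nsub t s * X.
Proof.
move=> fG fT ts cov X0 hX.
have GE : over G set0 = G by apply/setP => A; rewrite inE sub0set andbT.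
rewrite /nsub; have -> : Q ^+ (s - t) = Q ^+ s / Q ^+ t.
  by rewrite -{2}(subnK ts) exprD mulfK // gt_eqF ?QX_gt0.
rewrite -mulrA mulrAC ler_pdivlMr ?QX_gt0 // -{1}GE.
apply: (over_trace_le (B := T)).
- by move=> A; rewrite GE setD0 -natrX ler_nat; apply: cov.
- by rewrite setD0 (card_flat fT) natrX.
- by rewrite mulr_ge0 // divr_ge0 // ltW // gauss_num_gt0.
move=> x; rewrite setD0 GE => xT.
rewrite /gauss_num -prodf_div.
rewrite -(big_mkord predT (fun i => (Q ^+ s - Q ^+ i) / (Q ^+ t - Q ^+ i))).
by apply: (card_over_cover (d := t) fG fT) => //; rewrite ?flat_set1 ?sub1set.
Qed.

(** * Comparison of the costs with the count through a fixed flat *)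

Lemma cover_cost_lt k k' t s : (t.+1 < s <= k)%N -> (k + k' + 3 <= n)%N ->
  nsub t.+1 s *
    ext k' t ^+ (s - t.+1) * nflats k (k - s) <
  nflats k (k - t.+1).
Proof.
move=> /andP[ts sk] kn.
have [m sE] : exists m, s = (t.+1 + m.+1)%N by exists (s - t.+2)%N; lia.
have Q2 := Q_ge2.
rewrite /nsub; have -> : (s - t.+1 = m.+1)%N by lia.
have nf0 : 0 < nflats k (k - s) by apply: nflats_gt0; lia.
have kE : (k - t.+1 = k - s + m.+1)%N by lia.
apply: (@lt_le_trans _ _ ((Q ^+ (n - k)) ^+ m.+1 * nflats k (k - s))); last first.
  by rewrite kE; apply: nflats_growth; lia.
rewrite ltr_pM2r //.
apply: (@lt_le_trans _ _ ((Q ^+ (k' + 3)) ^+ m.+1)); last first.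
  by apply: lerXn2r; rewrite ?nnegrE ?(ltW (QX_gt0 _)) ?QX_le //; lia.
have g0 : 0 < gauss_num t.+1 t.+1 by exact: gauss_num_gt0.
(* Per dimension above [t.+1] the loss has three factors: [q] from [q^(s - t.+1)], less than
   [(q - 1) q^(t+2)] on average from the Gaussian quotient, and [ext k' t]. The bounds multiply to
   exactly [q^(k'+3)], at most the gain [q^(n-k)]. *)
have -> : Q ^+ (k' + 3) = Q * ((Q - 1) * Q ^+ t.+2) * ext k' t.
  rewrite /ext; have -> : Q ^+ t.+1 - Q ^+ t = (Q - 1) * Q ^+ t by rewrite exprS; ring.
  rewrite exprD !exprS; field.
  by rewrite gt_eqF ?QX_gt0 // subr_eq0 gt_eqF // (lt_le_trans _ Q2).
rewrite [ltRHS]exprMn ltr_pM2r ?exprn_gt0 ?ext_gt0 // [ltRHS]exprMn ltr_pM2l ?QX_gt0 //.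
by rewrite ltr_pdivrMr // sE gauss_num_lt.
Qed.

Lemma cover_cost_le k k' t s : (t.+1 <= s <= k)%N -> (k + k' + 3 <= n)%N ->
  nsub t.+1 s *
    ext k' t ^+ (s - t.+1) * nflats k (k - s) <=
  nflats k (k - t.+1).
Proof.
move=> /andP[]; rewrite leq_eqVlt => /orP[/eqP <- | ts] sk kn; last first.
  by apply/ltW/cover_cost_lt; rewrite ?ts.
by rewrite nsubnn subnn expr0 !mul1r.
Qed.

(** * Minimal covers and the extremal pairs *)

Lemma minimal_cover k k' t G G' :
  flat_family k G -> flat_family k' G' -> G != set0 -> G' != set0 ->
  (forall A B, A \in G -> B \in G' -> q ^ t <= #|A :&: B|)%N ->
  exists s T, [/\ (t <= s <= k')%N, flat s T,
    forall A, A \in G -> (q ^ t <= #|A :&: T|)%N &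
    forall j R, flat j R -> (j < s)%N ->
      exists2 A, A \in G & (#|R :&: A| < q ^ t)%N].
Proof.
move=> fG fG' /set0Pn[A0 A0G] /set0Pn[B0 B0G'] cross.
pose P s := [exists T, flat s T && [forall A in G, q ^ t <= #|A :&: T|]%N].
have Pk' : P k'.
  apply/existsP; exists B0; apply/andP; split; first exact/flatP/fG'.
  by apply/forall_inP => A AG; apply: cross.
have exP : exists s, P s by exists k'.
case: (ex_minnP exP) => s /existsP[T /andP[fT /forall_inP cT]] mins.
exists s, T; split=> //.
  rewrite mins // andbT -(leq_exp2l _ _ (q_gt1)) -(card_flat fT).
  by rewrite (leq_trans (cT _ A0G)) // subset_leq_card // subsetIr.
move=> j R fR js.
have [/existsP[A /andP[AG RA]] | noA] :=
  boolP [exists A, (A \in G) && (#|R :&: A| < q ^ t)%N]; first by exists A.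
have Pj : P j; last by have := mins _ Pj; rewrite leqNgt js.
apply/existsP; exists R; rewrite fR; apply/forall_inP => A AG.
by rewrite leqNgt setIC; apply: contra noA => RA; apply/existsP; exists A; rewrite AG.
Qed.

Lemma maximal_cross_intersecting k k' t G G' :
  (t.+1 <= k)%N -> (t.+1 <= k')%N -> (k + k' + 3 <= n)%N ->
  flat_family k G -> flat_family k' G' ->
  (forall A B, A \in G -> B \in G' -> q ^ t.+1 <= #|A :&: B|)%N ->
  nflats k (k - t.+1) * nflats k' (k' - t.+1) <= #|G|%:R * #|G'|%:R ->
  exists T, [/\ flat t.+1 T, forall A, A \in G -> T \subset A &
                forall B, B \in G' -> T \subset B].
Proof.
move=> tk tk' kn fG fG' cross big.
have m0 : 0 < nflats k (k - t.+1) by apply: nflats_gt0; lia.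
have m0' : 0 < nflats k' (k' - t.+1) by apply: nflats_gt0; lia.
have : 0 < #|G|%:R * #|G'|%:R :> rat by apply: lt_le_trans big; rewrite mulr_gt0.
rewrite -natrM ltr0n muln_gt0 !card_gt0 => /andP[G0 G0'].
have cross' B A : B \in G' -> A \in G -> (q ^ t.+1 <= #|B :&: A|)%N.
  by move=> BG' AG; rewrite setIC cross.
have [s [T [/andP[ts sk'] fT cT minT]]] := minimal_cover fG fG' G0 G0' cross.
have [s' [T' [/andP[ts' sk] fT' cT' minT']]] := minimal_cover fG' fG G0' G0 cross'.
have dk : (k - s' <= k <= n)%N by lia.
have dk' : (k' - s <= k' <= n)%N by lia.
have tsk : (t.+1 <= s' <= k)%N by rewrite ts'.
have tsk' : (t.+1 <= s <= k')%N by rewrite ts.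
have skn : (s' <= k <= n)%N by lia.
have skn' : (s <= k' <= n)%N by lia.
have kn' : (k' + k + 3 <= n)%N by lia.
have kk'n : (k + k' < n)%N by lia.
have c0 := nflats_gt0 dk; have c0' := nflats_gt0 dk'.
have a0 := nsub_gt0 ts; have a0' := nsub_gt0 ts'.
have b0 : 0 < ext k' t ^+ (s' - t.+1) by rewrite exprn_gt0 ?ext_gt0.
have b0' : 0 < ext k t ^+ (s - t.+1) by rewrite exprn_gt0 ?ext_gt0.
have GT : #|G|%:R <=
    nsub t.+1 s * (ext k' t ^+ (s' - t.+1) * nflats k (k - s')).
  apply: (card_cover fG fT) => // [|R fR]; first by rewrite ltW ?mulr_gt0.
  by apply: (card_over_noncover fG fG' cross minT' skn fR); rewrite subnKC.
have GT' : #|G'|%:R <=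
    nsub t.+1 s' * (ext k t ^+ (s - t.+1) * nflats k' (k' - s)).
  apply: (card_cover fG' fT') => // [|R fR]; first by rewrite ltW ?mulr_gt0.
  by apply: (card_over_noncover fG' fG cross' minT skn' fR); rewrite subnKC.
have le1 := cover_cost_le tsk kn; have le2 := cover_cost_le tsk' kn'.
pose a := nsub t.+1 s; pose a' := nsub t.+1 s'.
pose b := ext k' t ^+ (s' - t.+1); pose b' := ext k t ^+ (s - t.+1).
pose c := nflats k (k - s'); pose c' := nflats k' (k' - s).
rewrite -/a -/a' -/b -/b' -/c -/c' in a0 a0' b0 b0' c0 c0' GT GT' le1 le2.
have p0 : 0 < a' * b * c by do 2!apply: mulr_gt0 => //.
have p0' : 0 < a * b' * c' by do 2!apply: mulr_gt0 => //.
(* Swapping [a] and [a'] leaves one bracket depending only on [s'] and the other only on [s], so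
   that [cover_cost_lt] applies to each. *)
have prod : #|G|%:R * #|G'|%:R <= (a' * b * c) * (a * b' * c').
  have shuffle (u u' v v' w w' : rat) :
    (u' * v * w) * (u * v' * w') = (u * (v * w)) * (u' * (v' * w')) by ring.
  by rewrite shuffle; apply: ler_pM.
have sE : s = t.+1.
  apply/eqP; rewrite eqn_leq ts andbT leqNgt; apply/negP => ts2.
  have : (a' * b * c) * (a * b' * c') < nflats k (k - t.+1) * nflats k' (k' - t.+1).
    apply: (@le_lt_trans _ _ (nflats k (k - t.+1) * (a * b' * c'))).
      by rewrite ler_wpM2r // ltW.
    by rewrite ltr_pM2l //; apply: cover_cost_lt; rewrite ?ts2.
  by rewrite ltNge (le_trans big prod).
have sE' : s' = t.+1.
  apply/eqP; rewrite eqn_leq ts' andbT leqNgt; apply/negP => ts2.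
  have : (a' * b * c) * (a * b' * c') < nflats k (k - t.+1) * nflats k' (k' - t.+1).
    apply: (@le_lt_trans _ _ ((a' * b * c) * nflats k' (k' - t.+1))).
      by rewrite ler_wpM2l // ltW.
    by rewrite ltr_pM2r //; apply: cover_cost_lt; rewrite ?ts2.
  by rewrite ltNge (le_trans big prod).
subst s s'.
have TG A : A \in G -> T \subset A.
  move=> AG; have : A :&: T == T by rewrite eqEcard subsetIr (card_flat fT) cT.
  by move/eqP <-; exact: subsetIl.
have {}GT' : #|G'|%:R <= nflats k' (k' - t.+1).
  by move: GT'; rewrite /a' /b' nsubnn subnn expr0 !mul1r.
(* The bound on [G'] and [big] force [G] to have as many members as there are [k]-flats through
   [T]. *)
have GE : G = over (flats k) T.
  apply/eqP; rewrite eqEcard; apply/andP; split.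
    by apply/subsetP => A AG; rewrite !inE TG // andbT; apply/flatP/fG.
  rewrite -(ler_nat rat) (@card_over_flats k (k - t.+1)); first last.
  - by rewrite subKn.
  - by rewrite leq_subr; case/andP: dk.
  by rewrite -(ler_pM2r m0') (le_trans big) // ler_wpM2l.
exists T; split=> // B BG'.
have fB : flat k' B by apply/flatP/fG'.
have [A [fA TA ABT]] := flat_extend_avoiding fT fB tk kk'n.
have AG : A \in G by rewrite GE !inE fA TA.
have : A :&: B == T by rewrite eqEcard ABT (card_flat fT) cross.
by move/eqP <-; exact: subsetIr.
Qed.

End Flats.

Theorem theorem1p1 (F : finFieldType) (n k1 k2 t : nat)
    (F1 F2 : {set {set 'rV[F]_n}}) :
  0 < n -> 0 < k1 -> 0 < k2 -> 0 < t ->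
  t <= k1 -> t <= k2 -> k1 + k2 + 3 <= n ->
  flat_family k1 F1 -> flat_family k2 F2 -> cross_intersecting t F1 F2 ->
  (forall G1 G2 : {set {set 'rV[F]_n}},
      flat_family k1 G1 -> flat_family k2 G2 -> cross_intersecting t G1 G2 ->
      #|G1| * #|G2| <= #|F1| * #|F2|) ->
  exists T : {set 'rV[F]_n},
    is_flat t T /\
    (forall A, A \in F1 -> T \subset A) /\
    (forall B, B \in F2 -> T \subset B).
Proof.
(* The threshold is written [t.+1] so that an intersection falling short of it has at most [q^t]
   points. *)
move=> _ _ _; case: t => // t _ tk1 tk2 kn fF1 fF2 cross maxF.
have crossP A B : A \in F1 -> B \in F2 -> #|F| ^ t.+1 <= #|A :&: B|.
  move=> AF1 BF2; apply/(flat_dim_geP _ (a := k1) (b := k2)).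
  - exact/flatP/fF1.
  - exact/flatP/fF2.
  exact: cross.
have [|T0 fT0] := @flat_exists F n t.+1; first lia.
(* The competing pair consists of all [k1]-flats and all [k2]-flats through [T0]. *)
have fam k : flat_family k (over (flats F n k) T0).
  exact/over_family/flats_family.
have card_fam k : t.+1 <= k -> k <= n ->
    (#|over (flats F n k) T0|%:R = nflats F n k (k - t.+1))%R.
  move=> tk kn'; apply: card_over_flats; first lia.
  by have -> : k - (k - t.+1) = t.+1 by lia.
have [|T [fT TF1 TF2]] :=
  maximal_cross_intersecting tk1 tk2 kn fF1 fF2 crossP.
  rewrite -!card_fam -?natrM ?ler_nat; try lia.
  apply: maxF => // A B; rewrite !inE => /andP[fA T0A] /andP[fB T0B].
  apply/(flat_dim_geP _ fA fB); rewrite -(card_flat fT0) subset_leq_card //.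
  by rewrite subsetI T0A.
by exists T; split; first exact/flatP.
Qed.
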